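(* Let $Q$ be a differentially closed quasifield and let $X\subseteq Q^n$ be an arbitrary quasivariety. Then $$Q\{X\}=\mathcal O_X(X),$$ i.e. a function $X\to Q$ is regular on $X$ if and only if it is the restriction to $X$ of a differential polynomial function.
   Context: A differential ring is a commutative associative unital ring with a fixed finite set $\Delta$ of pairwise commuting derivations (the same $\Delta$ for all rings). $\Theta$ is the free commutative monoid generated by $\Delta$, acting as derivative operators. All rings have nonzero characteristic. A quasifield is a nonzero differential ring of nonzero characteristic whose only differential ideals are $0$ and the whole ring. (It is known that a quasifield is a local ring of Krull dimension $0$, of prime characteristic $p$, with maximal ideal $\{x\mid x^p=0\}$; so every non-nilpotent element is invertible.) $Q\{y_1,\ldots,y_n\}$ is the polynomial ring over $Q$ in the $\theta y_i$ ($\theta\in\Theta$, $1\le i\le n$) with the obvious derivations. For $E\subseteq Q\{y_1,\ldots,y_n\}$, $V(E)\subseteq Q^n$ is the set of common zeros of $E$; for $X\subseteq Q^n$, $I(X)$ is the set of differential polynomials vanishing on $X$. For a differential ideal $\mathfrak a$, $\mathfrak{rad}(\mathfrak a)=\{f\mid\theta f\text{ is nilpotent modulo }\mathfrak a\text{ for all }\theta\in\Theta\}$. $Q$ is differentially closed if $\mathfrak{rad}(\mathfrak a)=I(V(\mathfrak a))$ for every $n$ and every differential ideal $\mathfrak a$ of $Q\{y_1,\ldots,y_n\}$. A quasivariety in $Q^n$ is a subset of the form $V(E)$. The sets $V(E)$ are the closed sets of a topology on $Q^n$, and quasivarieties carry the subspace topology. $Q\{X\}$ is the ring of differential polynomial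 functions on $X$, i.e. restrictions to $X$ of the functions $Q^n\to Q$ defined by elements of $Q\{y_1,\ldots,y_n\}$; thus $Q\{X\}\cong Q\{y_1,\ldots,y_n\}/I(X)$. A function $f\colon X\to Q$ is regular at $x\in X$ if there are an open neighbourhood $U\subseteq X$ of $x$ and elements $h,g\in Q\{X\}$ such that for every $y\in U$ the element $g(y)$ is not nilpotent in $Q$ and $f(y)=h(y)/g(y)$. A function is regular on an open $U\subseteq X$ if it is regular at each point of $U$; $\mathcal O_X(U)$ is the ring of all regular functions on $U$. *)

(* Defs.v *)
From HB Require Import structures.
From mathcomp Require Import all_boot all_order all_algebra.
From mathcomp Require Import finmap.
From mathcomp.multinomials Require Import monalg.
From mathcomp Require Import boolp classical_sets.
From mathcomp Require Import ring.

Set Implicit Arguments.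
Unset Strict Implicit.
Unset Printing Implicit Defensive.

Import GRing.Theory.

Local Open Scope ring_scope.
Local Open Scope classical_set_scope.
Local Notation "1" := (@mone _) : monom_scope.
Local Notation "x * y" := (mmul x y) : monom_scope.

HB.mixin Record isDiffRing (Delta : finType) R of GRing.ComPzRing R := {
  der : Delta -> R -> R;
  derD : forall d, {morph der d : x y / x + y};
  derM : forall d x y, der d (x * y) = der d x * y + x * der d y;
  derC : forall d1 d2 x, der d1 (der d2 x) = der d2 (der d1 x)
}.

#[short(type="diffRingType")]
HB.structure Definition DiffRing (Delta : finType) :=
  { R of GRing.ComPzRing R & isDiffRing Delta R }.

(* Classically, every nonzero commutative ring carries a unitRingType structure; *)
(* it is only used to write quotients by invertible elements. *)
#[short(type="diffUnitRingType")]
HB.structure Definition DiffUnitRing (Delta : finType) :=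
  { R of GRing.ComUnitRing R & isDiffRing Delta R }.

Section DiffRings.
Context (Delta : finType).

(* theta x; the order of the derivations is irrelevant since they commute. *)
Definition derop (R : diffRingType Delta) (theta : {cmonom Delta}) (x : R) : R :=
  foldr (fun d => iter (theta d) (der d)) x (enum Delta).

Definition diff_ideal (R : diffRingType Delta) (a : set R) : Prop :=
  [/\ a 0, (forall x y, a x -> a y -> a (x + y)),
      (forall r x, a x -> a (r * x)) & (forall d x, a x -> a (der d x))].

Definition diff_rad (R : diffRingType Delta) (a : set R) : set R :=
  [set f | forall theta, exists k, a (derop theta f ^+ k)].

Definition nilpotent_elt (R : pzRingType) (x : R) : Prop := exists k, x ^+ k = 0.

(* Nonzero because unit rings are. *)
Definition quasifield (Q : diffUnitRingType Delta) : Prop :=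
  (exists2 m : nat, (0 < m)%N & m%:R = 0 :> Q) /\
  (forall a : set Q, diff_ideal a -> a = [set 0] \/ a = setT).

End DiffRings.

(* Purely ring-theoretic steps, isolated so as not to unfold the instances on *)
(* monoid algebras. *)
Section RingSteps.
Context (A : comNzRingType).

Lemma mulsum_split (J : Type) (r : seq J) (F G : J -> A) (a b : A) :
  (\sum_(i <- r) F i) * b + a * (\sum_(i <- r) G i) = \sum_(i <- r) (F i * b + a * G i).
Proof. by rewrite mulr_suml mulr_sumr -big_split. Qed.

Lemma leibniz_monom (k1 k2 : nat) (w x1 x2 u1 u2 z : A) :
  ((0 < k1)%N -> w = x1 * u2) -> ((0 < k2)%N -> w = u1 * x2) ->
  (w * z) *+ (k1 + k2) = (x1 * z) *+ k1 * u2 + u1 * ((x2 * z) *+ k2).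
Proof.
rewrite mulrnDr mulrnAl mulrnAr => E1 E2; congr (_ + _).
  by case: (posnP k1) => [->|/E1 ->]; rewrite ?mulr0n // mulrAC.
by case: (posnP k2) => [->|/E2 ->]; rewrite ?mulr0n // mulrA.
Qed.

Lemma leibniz_term (a b a' b' u1 u2 v1 v2 : A) :
  (a' * b + a * b') * (u1 * u2) + (a * b) * (v1 * u2 + u1 * v2) =
  (a' * u1 + a * v1) * (b * u2) + (a * u1) * (b' * u2 + b * v2).
Proof. ring. Qed.

Lemma morph_sum_mul (h : A -> A) (J1 J2 : Type) (r1 : seq J1) (r2 : seq J2)
    (F : J1 -> A) (G : J2 -> A) : {morph h : x y / x + y} ->
  (forall i j, h (F i * G j) = h (F i) * G j + F i * h (G j)) ->
  h ((\sum_(i <- r1) F i) * (\sum_(j <- r2) G j)) =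
  h (\sum_(i <- r1) F i) * (\sum_(j <- r2) G j)
    + (\sum_(i <- r1) F i) * h (\sum_(j <- r2) G j).
Proof.
move=> hD hM; have h0 : h 0 = 0 by apply: (addrI (h 0)); rewrite -hD !addr0.
have hS := big_morph h hD h0.
rewrite mulr_suml !hS !mulr_suml -big_split; apply: eq_bigr => i _ /=.
by rewrite !mulr_sumr hS -big_split; apply: eq_bigr => j _ /=.
Qed.

Lemma morph_commD (h1 h2 : A -> A) :
  {morph h1 : x y / x + y} -> {morph h2 : x y / x + y} ->
  forall x y, h1 (h2 x) = h2 (h1 x) -> h1 (h2 y) = h2 (h1 y) ->
  h1 (h2 (x + y)) = h2 (h1 (x + y)).
Proof. by move=> D1 D2 x y Ex Ey; rewrite D1 D2 D1 D2 Ex Ey. Qed.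

Lemma morph_commM (h1 h2 : A -> A) :
  {morph h1 : x y / x + y} -> {morph h2 : x y / x + y} ->
  (forall x y, h1 (x * y) = h1 x * y + x * h1 y) ->
  (forall x y, h2 (x * y) = h2 x * y + x * h2 y) ->
  forall x y, h1 (h2 x) = h2 (h1 x) -> h1 (h2 y) = h2 (h1 y) ->
  h1 (h2 (x * y)) = h2 (h1 (x * y)).
Proof.
move=> D1 D2 M1 M2 x y Ex Ey.
by rewrite M1 M2 D1 D2 !M1 !M2 Ex Ey -!addrA; congr (_ + _); rewrite addrCA.
Qed.

End RingSteps.

Section MalgDerivation.
Context (M : conomType) (R : comNzRingType).
Local Notation poly := {malg R[M]}.

(* The extension to R[M] of a derivation e of R, given its values dm on M. *)
Definition malg_der (e : R -> R) (dm : M -> poly) (f : poly) : poly :=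
  \sum_(m <- msupp f) (<< e f@_m *g m >> + (f@_m)%:MP * dm m).

Lemma malgUM (c1 c2 : R) (m1 m2 : M) :
  << c1 *g m1 >> * << c2 *g m2 >> = << c1 * c2 *g (m1 * m2)%M >> :> poly.
Proof. by rewrite malgM_def fgmulUU. Qed.

Lemma malgUE c (m : M) : << c *g m >> = c%:MP * << m >> :> poly.
Proof. by rewrite malgUM mulr1 mul1m. Qed.

Context (e : R -> R) (dm : M -> poly).
Hypothesis eD : {morph e : x y / x + y}.
Hypothesis eM : forall x y, e (x * y) = e x * y + x * e y.
Hypothesis dmM : forall m1 m2, dm (m1 * m2)%M = dm m1 * << m2 >> + << m1 >> * dm m2.
Local Notation der := (malg_der e dm).

Let e0 : e 0 = 0.
Proof. by apply: (addrI (e 0)); rewrite -eD !addr0. Qed.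

Let e1 : e 1 = 0.
Proof. by apply: (addrI (e 1)); rewrite addr0 -[in RHS](mulr1 1) eM mulr1 mul1r. Qed.

Let dm1 : dm 1%M = 0.
Proof.
by apply: (addrI (dm 1%M)); rewrite addr0 -[in RHS](mulm1 1%M) dmM mulr1 mul1r.
Qed.

Lemma malg_derEw (s : {fset M}) f : (msupp f `<=` s)%fset ->
  der f = \sum_(m <- s) (<< e f@_m *g m >> + (f@_m)%:MP * dm m).
Proof.
move=> le_fs; rewrite /malg_der (big_fset_incl _ le_fs) //= => m _ /mcoeff_outdom ->.
by rewrite e0 !monalgU0 mul0r addr0.
Qed.

Lemma malg_derD : {morph der : f g / f + g}.
Proof.
move=> f g; have le_fg := msuppD_le f g.
rewrite (malg_derEw le_fg) (malg_derEw (fsubsetUl _ (msupp g))).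
rewrite (malg_derEw (fsubsetUr (msupp f) _)) -big_split /=; apply: eq_bigr => m _.
by rewrite mcoeffD eD !monalgUD mulrDl addrACA.
Qed.

Lemma malg_derU c m : der << c *g m >> = << e c *g m >> + c%:MP * dm m.
Proof. by rewrite (malg_derEw msuppU_le) big_seq_fset1 mcoeffUU. Qed.

Lemma malg_derM f g : der (f * g) = der f * g + f * der g.
Proof.
rewrite [f]monalgE [g]monalgE; apply: morph_sum_mul; first exact: malg_derD.
move=> m1 m2; move: f@_m1 g@_m2 => a b.
rewrite malgUM !malg_derU dmM eM [<< _ *g (m1 * m2)%M >>]malgUE.
rewrite (malgUE a m1) (malgUE b m2) (malgUE (e a) m1) (malgUE (e b) m2).
have -> : << (m1 * m2)%M >> = << m1 >> * << m2 >> :> poly by rewrite malgUM mulr1.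
rewrite monalgUD !mpolyCM; exact: leibniz_term.
Qed.

Lemma malg_derC c : der c%:MP = (e c)%:MP.
Proof. by rewrite malg_derU dm1 mulr0 addr0. Qed.

Lemma malg_derX m : der << m >> = dm m.
Proof. by rewrite malg_derU e1 monalgU0 add0r mpolyC1E mul1r. Qed.

End MalgDerivation.

Section PolyDerivation.
Context (I : choiceType) (R : comNzRingType).
Local Notation U := (@ucm I).
Local Notation poly := {malg R[{cmonom I}]}.

Implicit Types (m : {cmonom I}).

(* The value on m = \prod_v v ^ m v of a derivation with values D v on v. *)
Definition monom_der (D : I -> poly) m : poly :=
  \sum_(v <- finsupp m) (<< divcm m (U v) >> * D v) *+ m v.

Lemma divcmMl m1 m2 v : (0 < m1 v)%N ->
  divcm (m1 * m2)%M (U v) = (divcm m1 (U v) * m2)%M.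
Proof.
move=> m1v; apply/eqP/cmP => w; rewrite divcmE !cmM divcmE cmU.
by case: eqP => [<-|_]; rewrite ?subn0 // addnBAC.
Qed.

Lemma malg_ind (P : poly -> Prop) :
  (forall c, P c%:MP) -> (forall v, P << U v >>) ->
  (forall f g, P f -> P g -> P (f + g)) ->
  (forall f g, P f -> P g -> P (f * g)) -> forall f, P f.
Proof.
move=> PC PX PD PM f; rewrite [f]monalgE.
have P0 : P 0 by rewrite -malgC0E.
apply: big_ind => // m _; rewrite malgUE; apply: (PM) => //.
move: {2}(mdeg m) (leqnn (mdeg m)) => k.
elim: k m => [|k IHk] m.
  by rewrite leqn0 mdeg_eq0 => /eqP ->; apply: PC.
have [m0|/fset0Pn[v mv]] := eqVneq (finsupp m) fset0.
  have ->: m = 1%M; last by move=> _; apply: PC.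
  by apply/eqP/cmP => v; rewrite cm1; apply/eqP; rewrite cmE_eq0 m0.
have m_v : (0 < m v)%N by rewrite lt0n cmE_neq0.
have -> : m = (U v * divcm m (U v))%M.
  apply/eqP/cmP => w; rewrite cmM divcmE cmU.
  by case: eqP => [<-|_]; rewrite ?subn0 // subnKC.
rewrite mdegM mdegU add1n ltnS => /IHk Pm.
have -> : << (U v * divcm m (U v))%M >> = << U v >> * << divcm m (U v) >> :> poly.
  by rewrite malgUM mulr1.
exact: (PM _ _ (PX v) Pm).
Qed.

Lemma malg_comm (h1 h2 : poly -> poly) (e1 e2 : R -> R) (s1 s2 : I -> I) :
  {morph h1 : f g / f + g} -> {morph h2 : f g / f + g} ->
  (forall f g, h1 (f * g) = h1 f * g + f * h1 g) ->
  (forall f g, h2 (f * g) = h2 f * g + f * h2 g) ->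
  (forall c, h1 c%:MP = (e1 c)%:MP) -> (forall c, h2 c%:MP = (e2 c)%:MP) ->
  (forall v, h1 << U v >> = << U (s1 v) >>) ->
  (forall v, h2 << U v >> = << U (s2 v) >>) ->
  (forall c, e1 (e2 c) = e2 (e1 c)) -> (forall v, s1 (s2 v) = s2 (s1 v)) ->
  forall f, h1 (h2 f) = h2 (h1 f).
Proof.
move=> D1 D2 M1 M2 C1 C2 X1 X2 eC sC; elim/malg_ind => [c|v|f g IHf IHg|f g IHf IHg].
- transitivity ((e1 (e2 c))%:MP : poly).
    exact: etrans (congr1 h1 (C2 c)) (C1 _).
  by rewrite eC; apply/esym/(etrans (congr1 h2 (C1 c)))/C2.
- transitivity (<< U (s1 (s2 v)) >> : poly).
    exact: etrans (congr1 h1 (X2 v)) (X1 _).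
  by rewrite sC; apply/esym/(etrans (congr1 h2 (X1 v)))/X2.
- exact: morph_commD D1 D2 f g IHf IHg.
- exact: morph_commM D1 D2 M1 M2 f g IHf IHg.
Qed.

Context (D : I -> poly).
Local Notation dm := (monom_der D).

Lemma monom_derEw (s : {fset I}) m : (finsupp m `<=` s)%fset ->
  dm m = \sum_(v <- s) (<< divcm m (U v) >> * D v) *+ m v.
Proof.
move=> le_ms; rewrite /monom_der (big_fset_incl _ le_ms) //= => v _.
by rewrite -cmE_eq0 => /eqP ->; rewrite mulr0n.
Qed.

Lemma monom_derM m1 m2 : dm (m1 * m2)%M = dm m1 * << m2 >> + << m1 >> * dm m2.
Proof.
rewrite (@monom_derEw (finsupp m1 `|` finsupp m2)%fset) ?mdomD //.
rewrite (monom_derEw (fsubsetUl _ (finsupp m2))).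
rewrite (monom_derEw (fsubsetUr (finsupp m1) _)).
rewrite mulsum_split; apply: eq_bigr => v _.
rewrite cmM; apply: leibniz_monom => [m1v|m2v].
  by rewrite divcmMl // malgUM mulr1.
by rewrite mulmC divcmMl // malgUM mulr1 mulmC.
Qed.

Lemma monom_derX v : dm (U v) = D v.
Proof.
rewrite /monom_der mdomU big_seq_fset1 cmUU mulr1n.
have -> : divcm (U v) (U v) = 1%M by apply/eqP/cmP => w; rewrite divcmE cm1 subnn.
by rewrite mpolyC1E mul1r.
Qed.

End PolyDerivation.

Section DiffPoly.
Context (Delta : finType) (Q : diffUnitRingType Delta) (n : nat).

(* Q{y_1, ..., y_n}; the pair (i, theta) indexes the indeterminate theta y_i. *)
Definition dpoly : Type := {malg Q[{cmonom ('I_n * {cmonom Delta})%type}]}.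

HB.instance Definition _ := GRing.ComNzRing.on dpoly.

(* The derivation extending d on Q and mapping theta y_i to (d theta) y_i. *)
Definition dpoly_der (d : Delta) : dpoly -> dpoly :=
  malg_der (der d) (monom_der (fun v => << ucm (v.1, (ucm d * v.2)%M) >>)).

Fact dpoly_derD d : {morph dpoly_der d : f g / f + g}.
Proof. exact/malg_derD/derD. Qed.

Fact dpoly_derM d f g : dpoly_der d (f * g) = dpoly_der d f * g + f * dpoly_der d g.
Proof. exact: malg_derM (derD d) (derM d) (@monom_derM _ _ _) f g. Qed.

Fact dpoly_derConst d c : dpoly_der d c%:MP = (der d c)%:MP.
Proof. exact: malg_derC (derD d) (@monom_derM _ _ _) c. Qed.

Fact dpoly_derVar d v : dpoly_der d << ucm v >> = << ucm (v.1, (ucm d * v.2)%M) >>.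
Proof. by rewrite /dpoly_der malg_derX ?monom_derX //; [exact: derD|exact: derM]. Qed.

Fact dpoly_derC d1 d2 f :
  dpoly_der d1 (dpoly_der d2 f) = dpoly_der d2 (dpoly_der d1 f).
Proof.
apply: (malg_comm (dpoly_derD d1) (dpoly_derD d2) (dpoly_derM d1) (dpoly_derM d2)
  (dpoly_derConst d1) (dpoly_derConst d2) (dpoly_derVar d1) (dpoly_derVar d2)).
  by move=> c; apply: derC.
by move=> v; rewrite /= !mulmA (mulmC (ucm d1)).
Qed.

HB.instance Definition _ :=
  isDiffRing.Build Delta dpoly dpoly_derD dpoly_derM dpoly_derC.

(* theta y_i is evaluated at theta (x_i). *)
Definition deval (x : 'rV[Q]_n) : dpoly -> Q :=
  mmap idfun (fun m : {cmonom ('I_n * {cmonom Delta})%type} =>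
    \prod_(v <- finsupp m) derop v.2 (x 0 v.1) ^+ m v).

Definition zeros (E : set dpoly) : set 'rV[Q]_n :=
  [set x | forall f, E f -> deval x f = 0].

Definition vanishing (X : set 'rV[Q]_n) : set dpoly :=
  [set f | forall x, X x -> deval x f = 0].

Definition quasivariety (X : set 'rV[Q]_n) : Prop := exists E, X = zeros E.

(* Open sets for the subspace topology of X, as sets of points of X. *)
Definition open_in (X : set 'rV[Q]_n) (W : set X) : Prop :=
  exists E : set dpoly, W = [set x : X | ~ zeros E (val x)].

(* X -> Q is the type of functions on the subtype of points of X; Q{X} is *)
(* dpoly_functions X and O_X(X) is regular_functions X. *)
Definition dpoly_functions (X : set 'rV[Q]_n) : set (X -> Q) :=
  [set f | exists p : dpoly, forall x : X, f x = deval (val x) p].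

Definition regular_at (X : set 'rV[Q]_n) (f : X -> Q) (x : X) : Prop :=
  exists W : set X, [/\ open_in W, W x & exists h g : X -> Q,
    [/\ dpoly_functions h, dpoly_functions g &
        forall y, W y -> ~ nilpotent_elt (g y) /\ f y = h y / g y]].

Definition regular_functions (X : set 'rV[Q]_n) : set (X -> Q) :=
  [set f | forall x, regular_at f x].

End DiffPoly.

Arguments dpoly_functions {Delta Q n} X.
Arguments regular_functions {Delta Q n} X.

Definition diff_closed (Delta : finType) (Q : diffUnitRingType Delta) : Prop :=
  forall (n : nat) (a : set (dpoly Q n)),
    diff_ideal a -> diff_rad a = vanishing (zeros a).

(* Main.v *)
(** If [f = h / g] near [x], choose [s] vanishing off this neighbourhood with
    [s(x) = 1]: then [c = (g s)^p] satisfies [c(x) <> 0] and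
    [f c = h g^(p-1) s^p] on all of [X]. Since [Q] has characteristic [p], every
    derivation kills [c], so these [c] together with [I(X)] generate a differential
    ideal merely by linear combinations, all of whose elements are denominators of
    [f] on [X]. This ideal has no zeros, so the Nullstellensatz hypothesis puts [1]
    in it, and [f] is polynomial. *)

From HB Require Import structures.
Require Import Defs.
From mathcomp Require Import all_boot all_algebra.
From mathcomp Require Import classical_sets.
From mathcomp Require Import finmap.
From mathcomp.multinomials Require Import monalg.
From mathcomp Require Import boolp.

Set Implicit Arguments.
Unset Strict Implicit.
Unset Printing Implicit Defensive.

Import GRing.Theory.

Local Open Scope ring_scope.
Local Open Scope classical_set_scope.
Local Notation "1" := (@mone _) : monom_scope.
Local Notation "x * y" := (mmul x y) : monom_scope.

(** * Derivations, prime characteristic and derivative operators *)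

Section DiffRingTheory.
Context (Delta : finType) (R : diffRingType Delta).
Implicit Types (d : Delta) (x y : R).

Lemma der0 d : der d (0 : R) = 0.
Proof. by apply: (addrI (der d (0 : R))); rewrite -derD !addr0. Qed.

Lemma der1 d : der d (1 : R) = 0.
Proof.
by apply: (addrI (der d (1 : R))); rewrite addr0 -[in RHS](mulr1 1) derM mulr1 mul1r.
Qed.

Lemma der_natmul d x k : der d (x *+ k) = der d x *+ k.
Proof. by elim: k => [|k IHk]; rewrite ?mulr0n ?der0 // !mulrS derD IHk. Qed.

Lemma der_exp d x k : der d (x ^+ k) = (x ^+ k.-1 * der d x) *+ k.
Proof.
elim: k => [|[|k] IHk]; first by rewrite expr0 der1 mulr0n.
  by rewrite expr0 mul1r.
by rewrite exprS derM IHk /= mulrnAr mulrA -exprS (mulrC (der d x)) -mulrS.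
Qed.

Lemma der_pchar_exp d x p : p%:R = 0 :> R -> der d (x ^+ p) = 0.
Proof. by move=> p0; rewrite der_exp -mulr_natl p0 mul0r. Qed.

Lemma derop_ucmM d (theta : {cmonom Delta}) x :
  derop (ucm d * theta)%M x = der d (derop theta x).
Proof.
have iterC d1 d2 k z : iter k (der d1) (der d2 z) = der d2 (iter k (der d1) z).
  by elim: k => //= k ->; rewrite derC.
rewrite /derop.
(* With [enum Delta] generalised to a list [s], the extra [d] acts once per occurrence of [d] in
   [s]; the enumeration contains it exactly once. *)
suff E s : foldr (fun d' => iter ((ucm d * theta)%M d') (der d')) x s =
    iter (count_mem d s) (der d) (foldr (fun d' => iter (theta d') (der d')) x s).
  by rewrite E count_uniq_mem ?enum_uniq // mem_enum.
elim: s => //= d' s ->; rewrite cmM cmU [d' == d]eq_sym.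
have iterCn k l z :
    iter k (der d') (iter l (der d) z) = iter l (der d) (iter k (der d') z).
  by elim: l => //= l IHl; rewrite iterC IHl.
rewrite iterCn.
by case: eqP => [->|_]; rewrite ?add0n // add1n addnC iterD.
Qed.

Lemma derop_mone x : derop 1%M x = x.
Proof. by rewrite /derop; elim: (enum Delta) => //= d s ->; rewrite cm1. Qed.

End DiffRingTheory.

(** The product case of the induction in [deval_der], stated for abstract rings. *)
Lemma leibniz_intertwine (A B : pzRingType) (h : A -> B) (dA : A -> A) (dB : B -> B) :
  {morph h : x y / x + y} -> {morph h : x y / x * y} ->
  (forall x y, dA (x * y) = dA x * y + x * dA y) ->
  (forall x y, dB (x * y) = dB x * y + x * dB y) ->
  forall x y, h (dA x) = dB (h x) -> h (dA y) = dB (h y) ->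
  h (dA (x * y)) = dB (h (x * y)).
Proof. by move=> hD hM AM BM x y hx hy; rewrite AM hD !hM BM hx hy. Qed.

(** * Prime characteristic and units of a quasifield *)

Section Quasifield.
Context (Delta : finType) (Q : diffUnitRingType Delta) (hQ : quasifield Q).

Lemma quasifield_ideal1 (a : set Q) (x : Q) :
  diff_ideal a -> a x -> x <> 0 -> a 1.
Proof.
by move=> /hQ.2[->|-> //] ax xn0; have := xn0 ax.
Qed.

(** Descent on [m] with [m = 0] in [Q]: let [p] be a prime divisor of [m]. If [p] is nonzero in [Q],
    its annihilator is a differential ideal without [1], hence zero; it contains [m / p], which is
    therefore zero in [Q] and smaller than [m]. *)
Lemma quasifield_pchar : exists2 p, prime p & p%:R = 0 :> Q.
Proof.
have [[m m0 mQ] _] := hQ; elim/ltn_ind: m m0 mQ => m IHm m0 mQ.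
have [m1|m1] := leqP m 1.
  have E : m = 1%N by apply/eqP; rewrite eqn_leq m1.
  by move/eqP: mQ; rewrite E oner_eq0.
pose p := pdiv m; have [pP pm] : prime p /\ (p %| m)%N by rewrite pdiv_prime ?pdiv_dvd.
have [p0|pn0] := pselect (p%:R = 0 :> Q); first by exists p.
have lt_qm : (m %/ p < m)%N by rewrite ltn_Pdiv ?prime_gt1.
have q_gt0 : (0 < m %/ p)%N by rewrite divn_gt0 ?prime_gt0 // dvdn_leq.
apply: (IHm _ lt_qm q_gt0).
apply: contrapT => q0.
suff /quasifield_ideal1 : diff_ideal [set x : Q | p%:R * x = 0].
  move=> /(_ (m %/ p)%N%:R); rewrite /= mulr1 => H; apply: pn0; apply: H => //.
  by rewrite -natrM mulnC divnK.
split => /= [|x y x0 y0|r x x0|d x x0]; first by rewrite mulr0.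
- by rewrite mulrDr x0 y0 addr0.
- by rewrite mulrCA x0 mulr0.
- by rewrite mulr_natl -der_natmul -mulr_natl x0 der0.
Qed.

(** The multiples of a constant form a differential ideal, which here is nonzero and so contains
    [1]. *)
Lemma quasifield_const_unit (x : Q) :
  (forall d, der d x = 0) -> x <> 0 -> x \is a GRing.unit.
Proof.
move=> dx xn0.
suff /quasifield_ideal1/(_ _ xn0) : diff_ideal [set y : Q | exists z, y = z * x].
  case=> [|z]; first by exists 1; rewrite mul1r.
  by move=> zx; apply/unitrPr; exists z; rewrite mulrC.
split => /= [|y1 y2 [z1 ->] [z2 ->]|r y [z ->]|d y [z ->]].
- by exists 0; rewrite mul0r.
- by exists (z1 + z2); rewrite mulrDl.
- by exists (r * z); rewrite mulrA.
- by exists (der d z); rewrite derM dx mulr0 addr0.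
Qed.

(** The power [x ^+ p] is a nonzero constant, hence a unit, and so is [x]. *)
Lemma quasifield_non_nilpotent (x : Q) : ~ nilpotent_elt x -> x \is a GRing.unit.
Proof.
have [p pP p0] := quasifield_pchar => xN.
rewrite -(unitrX_pos _ (prime_gt0 pP)); apply: quasifield_const_unit.
  by move=> d; apply: der_pchar_exp.
by move=> xp; apply: xN; exists p.
Qed.

End Quasifield.

(** * Evaluation at a point as a differential ring homomorphism *)

Section Evaluation.
Context (Delta : finType) (Q : diffUnitRingType Delta) (n : nat) (x : 'rV[Q]_n).
Local Notation monom := {cmonom ('I_n * {cmonom Delta})%type}.

(** The anonymous monomial function inside [deval], named so that it can carry a monoid morphism
    structure. *)
Definition meval (m : monom) : Q :=
  \prod_(v <- finsupp m) derop v.2 (x 0 v.1) ^+ m v.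

Lemma meval_is_multiplicative : mmorphism meval.
Proof.
have mevalE (s : {fset _}) (m : monom) : (finsupp m `<=` s)%fset ->
    meval m = \prod_(v <- s) derop v.2 (x 0 v.1) ^+ m v.
  move=> le_ms; rewrite /meval (big_fset_incl _ le_ms) //= => v _.
  by rewrite -cmE_eq0 => /eqP ->.
split=> [m1 m2|]; last by rewrite /meval mdom1 big_seq_fset0.
rewrite (mevalE (finsupp m1 `|` finsupp m2)%fset) ?mdomD //.
rewrite (mevalE _ m1 (fsubsetUl _ (finsupp m2))).
rewrite (mevalE _ m2 (fsubsetUr (finsupp m1) _)) -big_split /=.
by apply: eq_bigr => v _; rewrite cmM exprD.
Qed.

HB.instance Definition _ := isMultiplicative.Build monom Q meval meval_is_multiplicative.

Lemma devalD : {morph @deval _ Q n x : f g / f + g}.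
Proof. exact: mmapD. Qed.

Lemma devalM : {morph @deval _ Q n x : f g / f * g}.
Proof. exact: (mmap_is_multiplicative (f := idfun) (h := meval)).1. Qed.

Lemma devalMD f g h :
  @deval _ Q n x (f * g + h) = deval x f * deval x g + deval x h.
Proof. by rewrite devalD devalM. Qed.

Lemma devalC c : @deval _ Q n x c%:MP = c.
Proof. exact: (mmapC (f := idfun) (h := meval)). Qed.

Lemma deval0 : @deval _ Q n x 0 = 0.
Proof. exact: mmap0. Qed.

Lemma deval1 : @deval _ Q n x 1 = 1.
Proof. exact: devalC. Qed.

Lemma devalXn f k : @deval _ Q n x (f ^+ k) = deval x f ^+ k.
Proof. by elim: k => [|k IHk]; rewrite ?deval1 // !exprS devalM IHk. Qed.

Lemma devalX v : @deval _ Q n x << ucm v >> = derop v.2 (x 0 v.1).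
Proof.
rewrite /deval (mmapU (f := idfun)) /= mul1r mdomU big_seq_fset1 cmUU; exact: expr1.
Qed.

(** Both sides are additive and obey the Leibniz rule, so constants and variables suffice; for a
    variable this is [derop_ucmM]. *)
Lemma deval_der d (f : dpoly Q n) : deval x (der d f) = der d (deval x f).
Proof.
elim/malg_ind: f => [c|v|f g IHf IHg|f g IHf IHg].
- apply: etrans (congr1 (deval x) (dpoly_derConst n d c)) _.
  exact: etrans (devalC _) (congr1 (der d) (esym (devalC c))).
- apply: etrans (congr1 (deval x) (dpoly_derVar Q d v)) _.
  apply: etrans (devalX _) _; apply: etrans (derop_ucmM d _ _) _.
  by rewrite devalX.
- rewrite derD !devalD [RHS]derD; exact: congr2 IHf IHg.
- exact: (leibniz_intertwine devalD devalM (derM d) (derM d)).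
Qed.

End Evaluation.

(** * Separating a point from a closed set *)

Section Separation.
Context (Delta : finType) (Q : diffUnitRingType Delta) (n : nat).
Implicit Types (X : set 'rV[Q]_n) (E : set (dpoly Q n)).

Lemma vanishing_diff_ideal X : diff_ideal (vanishing X).
Proof.
split=> [x _|f g f0 g0 x Xx|r f f0 x Xx|d f f0 x Xx].
- exact: deval0.
- by rewrite devalD f0 // g0 // addr0.
- by rewrite devalM f0 // mulr0.
- by rewrite deval_der f0 // der0.
Qed.

(** The values at [y] of the polynomials vanishing on [zeros E] form a differential ideal of [Q]; it
    contains a nonzero value, hence [1]. *)
Lemma vanishing_separates (hQ : quasifield Q) E y :
  ~ zeros E y -> exists2 s, vanishing (zeros E) s & deval y s = 1.
Proof.
move=> /existsNP[e /not_implyP[Ee ey]].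
have [V0 VD VM Vder] := vanishing_diff_ideal (zeros E).
suff /(quasifield_ideal1 hQ)/(_ _ ey) :
    diff_ideal [set c | exists2 s, vanishing (zeros E) s & deval y s = c].
  by apply; exists e => // z; apply.
split=> [|_ _ [s Vs <-] [t Vt <-]|r _ [s Vs <-]|d _ [s Vs <-]].
- by exists 0; rewrite ?deval0.
- by exists (s + t); rewrite ?devalD //; apply: VD.
- by exists (r%:MP * s); rewrite ?devalM ?devalC //; apply: VM.
- by exists (der d s); rewrite ?deval_der //; apply: Vder.
Qed.

End Separation.

(** * Local denominators of a regular function *)

Section RegularFunctions.
Context (Delta : finType) (Q : diffUnitRingType Delta) (hQ : quasifield Q).
Context (n : nat) (X : set 'rV[Q]_n).
Local Notation dpoly := (dpoly Q n).

Lemma dpoly_functions_regular : dpoly_functions X `<=` regular_functions X.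
Proof.
move=> f fP x; exists setT; split => //.
  (* All of [X] is open, being the complement of the empty zero set of [1]. *)
  exists [set 1]; apply/esym/seteqP; split=> // y _ /(_ _ erefl).
  by move/eqP; rewrite deval1 oner_eq0.
exists f, (fun=> 1); split=> //; first by exists 1 => y; rewrite deval1.
move=> y _; rewrite divr1; split=> // -[k /eqP].
by rewrite expr1n oner_eq0.
Qed.

Lemma regular_denominator (f : X -> Q) (x : X) : regular_at f x ->
  exists c : dpoly, [/\ forall d, der d c = 0, deval (val x) c <> 0 &
    dpoly_functions X (fun y => f y * deval (val y) c)].
Proof.
have [p pP p0] := quasifield_pchar hQ; have p_gt0 := prime_gt0 pP.
move=> [_ [[E ->] /= Wx [fh [fg [[h hE] [g gE] W_hg]]]]].
have [s Vs sx] := vanishing_separates hQ Wx.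
exists ((g * s) ^+ p); split=> [d||].
- by apply: der_pchar_exp; rewrite -mpolyC_nat p0 malgC0E.
- rewrite devalXn devalM sx mulr1 -gE => gxp.
  by apply: (W_hg _ Wx).1; exists p.
exists (h * g ^+ p.-1 * s ^+ p) => y.
have den : deval (val y) ((g * s) ^+ p) = fg y ^+ p * deval (val y) s ^+ p.
  by rewrite devalXn devalM gE exprMn.
have num : deval (val y) (h * g ^+ p.-1 * s ^+ p) =
    fh y * fg y ^+ p.-1 * deval (val y) s ^+ p.
  rewrite (devalM _ (h * g ^+ p.-1)) (devalM _ h).
  by rewrite hE gE -!devalXn.
apply: etrans (congr1 ( *%R (f y)) den) (etrans _ (esym num)).
(* Off the neighbourhood [s] vanishes, and both sides are [0] because [p > 0]; on it, one factor of
   [g ^+ p] cancels the denominator, a unit since it is not nilpotent. *)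
have [sy|sy] := pselect (zeros E (val y)).
  by rewrite (Vs _ sy) expr0n gtn_eqF // !mulr0.
have [gy ->] := W_hg y sy.
rewrite -[in _ ^+ p](prednK p_gt0) exprS !mulrA mulrVK //.
exact: quasifield_non_nilpotent hQ _ gy.
Qed.

End RegularFunctions.

(** * The differential ideal of global denominators *)

Section Gluing.
Context (Delta : finType) (Q : diffUnitRingType Delta).
Context (n : nat) (X : set 'rV[Q]_n) (f : X -> Q).
Local Notation dpoly := (dpoly Q n).

(* The conductor {c | f c is polynomial on X} need not be a differential ideal, *)
(* as f cannot be differentiated; the ideal of its constants and I(X) is one. *)
Inductive denominators : set dpoly :=
| denominators_vanishing q : vanishing X q -> denominators q
| denominators_const r c q : (forall d, der d c = 0) ->
    dpoly_functions X (fun y => f y * deval (val y) c) ->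
    denominators q -> denominators (r * c + q).

Lemma denominators_diff_ideal : diff_ideal denominators.
Proof.
have [V0 VD VM Vder] := vanishing_diff_ideal X.
split; first exact: denominators_vanishing.
- move=> q1 q2 D1 D2; elim: D1 => [q Vq|r c q dc fc _ IHq]; last first.
    by rewrite -addrA; apply: denominators_const.
  elim: D2 => [q' Vq'|r c q' dc fc _ IHq'].
    by apply: denominators_vanishing; apply: VD.
  by rewrite addrCA; apply: denominators_const.
- move=> r q; elim=> [{}q Vq|r' c {}q dc fc _ IHq].
    by apply: denominators_vanishing; apply: VM.
  by rewrite mulrDr mulrA; apply: denominators_const.
- move=> d q; elim=> [{}q Vq|r c {}q dc fc _ IHq].
    by apply: denominators_vanishing; apply: Vder.
  (* As [c] is a constant, only its coefficient [r] is differentiated, so no derivative of [f] is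
     ever required. *)
  by rewrite derD derM dc mulr0 addr0; apply: denominators_const.
Qed.

Lemma denominators_mul q :
  denominators q -> dpoly_functions X (fun y => f y * deval (val y) q).
Proof.
elim=> [{}q Vq|r c {}q dc [h hE] _ [k kE]].
  by exists 0 => y; rewrite Vq ?mulr0 ?deval0 //; apply: set_valP.
exists (r * h + k) => y.
apply: etrans (congr1 ( *%R (f y)) (devalMD _ r c q)) _.
apply: etrans _ (esym (devalMD _ r h k)).
by rewrite mulrDr mulrCA hE kE.
Qed.

End Gluing.

Theorem theorem25 (Delta : finType) (Q : diffUnitRingType Delta)
    (hQ : quasifield Q) (hcl : diff_closed Q)
    (n : nat) (X : set 'rV[Q]_n) (hX : quasivariety X) :
  dpoly_functions X = regular_functions X.
Proof.
apply/seteqP; split; first exact: dpoly_functions_regular.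
move=> f f_reg.
(* A point of [X] is excluded by the local denominator there, a point outside [X] by a polynomial
   that vanishes on [X] and equals [1] at that point. *)
have noz y : ~ zeros (denominators f) y.
  move=> y0; have [Xy|/= Xy] := pselect (X y).
    have [c [dc cy fc]] := regular_denominator hQ (f_reg (SigSub (mem_set Xy))).
    apply: cy; rewrite -(mul1r c) -(addr0 (1 * c)); apply: y0.
    apply: denominators_const => //; apply: denominators_vanishing.
    by have [] := vanishing_diff_ideal X.
  have [E XE] := hX; rewrite XE in Xy.
  have [s Vs sy] := vanishing_separates hQ Xy.
  have /eqP : deval y s = 0 by apply/y0/denominators_vanishing; rewrite XE.
  by rewrite sy oner_eq0.
(* The polynomial [1] vanishes vacuously on the empty zero set. Taking the trivial operator in the
   radical, some power of [1], that is [1] itself, is a denominator. *)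
have /(_ 1%M)[k] : diff_rad (denominators f) 1.
  by rewrite (hcl _ _ (denominators_diff_ideal f)) => y /noz.
rewrite derop_mone expr1n => /denominators_mul[q qE].
by exists q => y; rewrite -qE deval1 mulr1.
Qed.
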